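(* Let $s\ge 0$ be an integer, let $M$ be a compact metric space, and let $T$ be a total order on $M$ such that $\operatorname{Snake}(M,T)\leqslant s$. Then the covering dimension satisfies $\dim M\leqslant s$.
   Context: A total order $T$ on a metric space $M$ is a strict total order $<_T$ on the set of points (for distinct $x,y$ exactly one of $x<_T y$, $y<_T x$ holds, and $<_T$ is transitive); no compatibility with the topology is assumed. $B_\varepsilon(x)$ denotes the open ball of radius $\varepsilon$ around $x$. For an ordered pair $(U_1,U_2)$ of subsets of $M$ and an integer $k\ge 0$, we say $(U_1,U_2)$ contains a snake of length $k$ if there are points $a_0 <_T a_1 <_T \dots <_T a_k$ such that $a_i\in U_1$ for all even $i$ and $a_i\in U_2$ for all odd $i$ ($0\le i\le k$). For distinct $x,y\in M$, $\operatorname{Snake}_T(x,y)$ is the greatest integer $k$ such that for every $\varepsilon>0$ the pair $(B_\varepsilon(x),B_\varepsilon(y))$ contains a snake of length $k$; if no greatest such number exists, $\operatorname{Snake}_T(x,y)=\infty$. The snake number of $(M,T)$ is $\operatorname{Snake}(M,T)=\sup_{x,y\in M,\,x\ne y}\operatorname{Snake}_T(x,y)\in\{0,1,2,\dots\}\cup\{\infty\}$, where the supremum is taken to be $0$ if $M$ has at most one point. Covering dimension: the order of a family $\mathcal A$ of sets is the largest integer $n$ such that $\mathcal A$ contains $n+1$ sets with non-empty intersection ($\infty$ if there is no such integer). For an integer $n\ge -1$, $\dim M\le n$ means that every finite open cover of $M$ has a finite open refinement of order $\le n$; $\dim M$ is the least such $n$, or $\infty$ if none exists; $\dim\emptyset=-1$.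 *)

(* Defs.v *)
From HB Require Import structures.
From mathcomp Require Import all_boot all_order all_algebra.
From mathcomp Require Import all_classical all_reals all_analysis.

Set Implicit Arguments.
Unset Strict Implicit.
Unset Printing Implicit Defensive.

Import Order.TTheory GRing.Theory Num.Theory.

Local Open Scope classical_set_scope.
Local Open Scope ring_scope.

(* The extended integers \bar int serve as the value type of orders of
   families, dimensions and snake numbers. *)

Definition greatest (A : set int) : \bar int :=
  xget +oo%E (EFin @` (A `&` ubound A)).

Definition least (A : set int) : \bar int :=
  xget +oo%E (EFin @` (A `&` lbound A)).

Definition strict_total_order (X : Type) (T : X -> X -> Prop) : Prop :=
  [/\ forall x, ~ T x x,
      forall x y, x <> y -> (T x y /\ ~ T y x) \/ (T y x /\ ~ T x y)
    & forall x y z, T x y -> T y z -> T x z].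

Section Snake.
Context {R : realType} {M : metricType R}.
Variable T : M -> M -> Prop.

(* Only the values a 0, ..., a k matter. *)
Definition contains_snake (U1 U2 : set M) (k : nat) : Prop :=
  exists a : nat -> M,
    (forall i, (i < k)%N -> T (a i) (a i.+1)) /\
    (forall i, (i <= k)%N -> if odd i then U2 (a i) else U1 (a i)).

Definition Snake_pt (x y : M) : \bar int :=
  greatest [set k%:Z | k in
    [set k : nat | forall e : R, 0 < e -> contains_snake (ball x e) (ball y e) k]].

(* [supremum 0 A] is 0 when A is empty, i.e. when M has at most one point. *)
Definition Snake : \bar int :=
  supremum 0%E [set Snake_pt p.1 p.2 | p in [set p : M * M | p.1 <> p.2]].

End Snake.

Section CoveringDimension.

(* The members of a family are counted as distinct sets.  The value -1 is
   always admitted: no member at all is needed for it, so a family all of whose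
   members are empty has order -1, also in an empty space. *)
Definition family_order (X : Type) (A : set (set X)) : \bar int :=
  greatest (-1 |` [set n%:Z | n in [set n : nat |
    exists B : set (set X),
      [/\ B `<=` A, (B #= `I_n.+1)%card & \bigcap_(U in B) U !=set0]]]).

Context {X : topologicalType}.

Definition finite_open_cover (A : set (set X)) : Prop :=
  [/\ finite_set A, forall U, A U -> open U & \bigcup_(U in A) U = [set: X]].

Definition refines (B A : set (set X)) : Prop :=
  forall V, B V -> exists2 U, A U & V `<=` U.

Definition covering_dim_le (n : int) : Prop :=
  forall A, finite_open_cover A ->
    exists B, [/\ finite_open_cover B, refines B A
                & (family_order B <= n%:E)%E].

Definition covering_dim : \bar int :=
  least [set n : int | -1 <= n /\ covering_dim_le n].

End CoveringDimension.

Arguments covering_dim X : clear implicits.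

(* Main.v *)
Require Import Defs.
From mathcomp Require Import all_boot all_order all_algebra.
From mathcomp Require Import all_classical all_reals all_analysis.
From mathcomp Require Import ring lra zify.

(* For every e > 0 there is a continuous map M -> R^s that separates points at
   distance >= e; pulling back a fine cover of R^s of order s then refines any
   given open cover of M.

   By compactness there is d > 0 such that no two d-balls whose centres are at
   distance >= e contain a snake of length s + 1.  Take a finite d-net
   c_0 <_T ... <_T c_(n-1), bumps phi_i supported in the d-ball around c_i, and
   send x to the barycentre of the points (i, i^2, ..., i^s) of the moment curve
   with weights phi_i(x) / sum_j phi_j(x).  If far points x and y have the same
   image, the difference w of their weights is orthogonal to all polynomials in
   i of degree at most s, so w has at least s + 1 sign changes.  Points c_i at
   which w alternates lie alternately near x and near y: they form a snake of
   length s + 1. *)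

Set Implicit Arguments.
Unset Strict Implicit.
Unset Printing Implicit Defensive.

Import Order.TTheory GRing.Theory Num.Theory.
Import numFieldNormedType.Exports.

Local Open Scope classical_set_scope.
Local Open Scope ring_scope.

(** * Greatest and least integers, suprema of extended integers *)

Lemma int_ubound_has_maximum (A : set int) (b : int) :
  A !=set0 -> ubound A b -> exists2 m, A m & ubound A m.
Proof.
move=> [a Aa] Ab.
have [||m [Am mP]] := @int_lbound_has_minimum (-%R @` A) (- b).
- by exists (- a), a.
- by move=> _ [x Ax <-]; rewrite lerN2; exact: Ab.
case: Am => n An nm; exists n => // x Ax.
by rewrite -lerN2 nm; apply: mP; exists x.
Qed.

Lemma greatest_le (A : set int) (b : int) :
  A !=set0 -> ubound A b -> (greatest A <= b%:E)%E.
Proof.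
move=> A0 Ab; have [m Am mA] := int_ubound_has_maximum A0 Ab.
rewrite /greatest; case: xgetP => [_ _ [x [Ax _] <-]|/(_ m%:E)].
  by rewrite lee_fin; exact: Ab.
by case; exists m.
Qed.

(** The default value [+oo] lies above every integer, so a finite bound on [greatest A] means that a
    maximum exists. *)
Lemma greatest_ubound (A : set int) (b : int) :
  (greatest A <= b%:E)%E -> ubound A b.
Proof.
rewrite /greatest; case: xgetP => [_ _ [x [_ xA] <-]|]; last by rewrite leNgt ltry.
by rewrite lee_fin => xb y /xA yx; exact: le_trans xb.
Qed.

Lemma least_le (A : set int) (a b : int) : lbound A a -> A b ->
  (least A <= b%:E)%E.
Proof.
move=> Aa Ab; have [|m [Am mA]] := int_lbound_has_minimum _ Aa; first by exists b.
rewrite /least; case: xgetP => [_ _ [x [_ xA] <-]|/(_ m%:E)].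
  by rewrite lee_fin; exact: xA.
by case; exists m.
Qed.

Lemma has_supremum_bar_int (A : set (\bar int)) (a : int) :
  A a%:E -> supremums A !=set0.
Proof.
move=> Aa; have [[b Ab]|nb] := pselect (exists b : int, ubound A b%:E).
  have [||m [Am mA]] := @int_lbound_has_minimum [set b | ubound A b%:E] a.
  - by exists b.
  - by move=> c /(_ _ Aa); rewrite lee_fin.
  exists m%:E; split => // -[c cA||].
  - by rewrite lee_fin; exact: mA.
  - by move=> _; rewrite leey.
  - by move=> /(_ _ Aa); rewrite leNgt ltNyr.
exists +oo%E; split; first by move=> x _; rewrite leey.
move=> [c cA||] //; first by exfalso; apply: nb; exists c.
by move=> /(_ _ Aa); rewrite leNgt ltNyr.
Qed.

(** [supremum] is a choice, so a supremum must first be shown to exist. Non-negativity excludes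
    [-oo]; if [A] contains no integer, only [+oo] is left. *)
Lemma supremum_bar_int_ub (A : set (\bar int)) (x0 : \bar int) :
  (forall x, A x -> (0 <= x)%E) -> ubound A (supremum x0 A).
Proof.
move=> A0 x Ax; rewrite /supremum ifF; last by apply/negP => /eqP Ae; rewrite Ae in Ax.
have [m mA] : supremums A !=set0.
  have [[a Aa]|na] := pselect (exists a : int, A a%:E).
    exact: has_supremum_bar_int Aa.
  have Ay y : A y -> y = +oo%E.
    by case: y => [y Ay||/A0//]//; exfalso; apply: na; exists y.
  exists +oo%E; split; first by move=> y _; rewrite leey.
  by move=> y /(_ _ Ax); rewrite (Ay _ Ax).
by case: xgetP => [z _ [zA _]|/(_ m)//]; exact: zA.
Qed.

Lemma greatest_ge (A : set int) (a : int) : A a -> (a%:E <= greatest A)%E.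
Proof.
move=> Aa; rewrite /greatest; case: xgetP => [_ _ [x [_ xA] <-]|_].
  by rewrite lee_fin; exact: xA.
by rewrite leey.
Qed.

(** * Usable forms of the bounds on snake number, order and dimension *)

Lemma Snake_no_snake (R : realType) (M : metricType R) (T : M -> M -> Prop)
    (s : nat) (x y : M) : (Snake T <= (s%:Z)%:E)%E -> x <> y ->
  exists2 e : R, 0 < e & ~ contains_snake T (ball x e) (ball y e) s.+1.
Proof.
move=> sT xy; apply: contrapT => nex.
(* One point is a snake of length 0, so no [Snake_pt] is negative. *)
have Tge0 z : [set Snake_pt T p.1 p.2 | p in [set p : M * M | p.1 <> p.2]] z ->
    (0 <= z)%E.
  move=> [[u v] /= _ <-]; apply: greatest_ge; exists 0%N => // e e0.
  by exists (fun=> u); split=> // i; rewrite leqn0 => /eqP ->; exact: ballxx.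
have := supremum_bar_int_ub 0%E Tge0.
move=> /(_ (Snake_pt T x y)) Sxy.
have {}Sxy := Sxy (ex_intro2 _ _ (x, y) xy erefl).
suff /(greatest_ubound (le_trans Sxy sT)) :
    [set k%:Z | k in [set k : nat | forall e : R, 0 < e ->
      contains_snake T (ball x e) (ball y e) k]] s.+1%:Z.
  by rewrite lez_nat ltnn.
exists s.+1 => // e e0.
by apply: contrapT => ns; apply: nex; exists e.
Qed.

(** The list [f] may vary with [x]: later it consists of the cells around [x] in the [s + 1]
    grids. *)
Lemma family_order_le (X : Type) (A : set (set X)) (s : nat) :
  (forall x, exists f : 'I_s.+1 -> set X,
     forall U, A U -> U x -> exists c, U = f c) ->
  (family_order A <= (s%:Z)%:E)%E.
Proof.
move=> Af; apply: greatest_le; first by exists (-1); left.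
move=> _ [->//|[n [B [BA Bn [x xB]]] <-]].
have [f fP] := Af x; rewrite lez_nat -ltnS -card_le_II.
rewrite -(card_le_eql Bn) (card_le_eqr (@card_II s.+1)).
apply: card_le_trans (card_image_le f _); apply: subset_card_le => U BU.
by have [c ->] := fP _ (BA _ BU) (xB _ BU); exists c.
Qed.

Lemma covering_dim_least (X : topologicalType) (s : nat) :
  covering_dim_le (X := X) s%:Z -> (covering_dim X <= (s%:Z)%:E)%E.
Proof. by move=> Xs; apply: (@least_le _ (-1)) => [n []|]//; split. Qed.

(** * Sign changes forced by vanishing moments *)

(** Here [w] is orthogonal to all polynomials of degree below [d]. With fewer than [d] sign changes,
    a polynomial of the same sign pattern would give a positive sum; the induction builds it one
    linear factor at a time. *)
Lemma moments_alternation (R : realFieldType) (d n : nat) (w : nat -> R) (i0 : nat) :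
  (i0 < n)%N -> 0 < w i0 -> (forall i, (i < i0)%N -> w i = 0) ->
  (forall k, (k < d)%N -> \sum_(i < n) w i * i%:R ^+ k = 0) ->
  exists a : nat -> nat,
    [/\ forall i, (i < d)%N -> (a i < a i.+1)%N,
        forall i, (i <= d)%N -> (a i < n)%N
      & forall i, (i <= d)%N -> 0 < (-1) ^+ i * w (a i)].
Proof.
elim: d w => [|d IHd] w i0n wi0 w0 moments.
  exists (fun=> i0); split=> // i; rewrite leqn0 => /eqP ->.
  by rewrite expr0 mul1r.
have exj : exists j, (j < n)%N && (w j < 0).
  have := moments 0%N isT; under eq_bigr do rewrite mulr1.
  rewrite (bigD1 (Ordinal i0n)) //= => /eqP sum0; apply: contrapT => nexj; move: sum0; apply/negP.
  rewrite gt_eqF // ltr_wpDr // sumr_ge0 // => j _; rewrite leNgt.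
  by apply/negP => wj; apply: nexj; exists j; rewrite ltn_ord.
have [j /andP[jn wj] jmin] := ex_minnP exj.
have w_ge0 i : (i < j)%N -> 0 <= w i.
  move=> ij; rewrite leNgt; apply/negP => wi.
  by have := jmin i; rewrite wi (ltn_trans ij jn) leqNgt ij => /(_ isT).
have i0j : (i0 < j)%N.
  rewrite ltnNge; apply/negP; rewrite leq_eqVlt => /orP[/eqP ji|/w0 wj0].
    by move: wj; rewrite ji ltNge ltW.
  by move: wj; rewrite wj0 ltxx.
(* The factor [j - 1/2 - i] removes the first sign change of [w], at [j], at
   the cost of one moment. *)
pose v i := w i * (j%:R - 2^-1 - i%:R).
have pos_factor i : (i < j)%N -> 0 < j%:R - 2^-1 - i%:R :> R.
  by rewrite -(ler_nat R) -natr1 => ij; lra.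
have neg_factor i : (j <= i)%N -> j%:R - 2^-1 - i%:R < 0 :> R.
  by rewrite -(ler_nat R) => ij; lra.
have [|||a [a_incr a_n a_alt]] := IHd v i0n.
- by rewrite mulr_gt0 ?pos_factor.
- by move=> i /w0; rewrite /v => ->; rewrite mul0r.
- move=> k kd; transitivity
    ((j%:R - 2^-1) * (\sum_(i < n) w i * i%:R ^+ k) -
     \sum_(i < n) w i * i%:R ^+ k.+1).
    rewrite mulr_sumr -sumrB; apply: eq_bigr => i _.
    by rewrite /v exprS; ring.
  by rewrite !moments ?mulr0 ?subr0 // ltnW.
(* [v] is non-negative before [j] and positive at [j], so its negative value at [a 1] comes after
   [j]. *)
have ja1 : (0 < d)%N -> (j < a 1%N)%N.
  move=> d0; have := a_alt 1%N d0; rewrite expr1 mulN1r oppr_gt0 /v => va.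
  have ja : (j <= a 1%N)%N.
    rewrite leqNgt; apply/negP => aj; move: va; rewrite ltNge.
    by rewrite mulr_ge0 ?w_ge0 ?ltW ?pos_factor.
  rewrite ltn_neqAle ja andbT; apply/negP => /eqP ja1.
  by move: va; rewrite -ja1 ltNge mulr_le0 ?ltW ?neg_factor.
have ja i : (i < d)%N -> (j < a i.+1)%N.
  elim: i => [/ja1//|i IHi id]; apply: ltn_trans (a_incr _ id).
  by apply: IHi; apply: ltnW.
(* [i0] and [j] replace [a 0]. Past [j] the factor is negative, which makes up for the shift of the
   later indices by one. *)
exists (fun i => if i is i'.+1 then (if i' is _.+1 then a i' else j) else i0).
split=> [[|[|i]]|[|[|i]]|[|[|i]]] //.
- by move=> id; exact: a_incr.
- by move=> id; exact: a_n.
- by rewrite mul1r.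
- by rewrite expr1 mulN1r oppr_gt0.
- move=> id; have := a_alt i.+1 id; rewrite /v /= mulrA => va.
  rewrite exprS mulN1r mulNr oppr_gt0.
  by rewrite -(nmulr_lgt0 _ (neg_factor _ (ltnW (ja _ id)))).
Qed.

(** * Finite subcovers and uniform bounds from compactness *)

Lemma compact_nbhs_subcover (X : topologicalType) (f : X -> set X) :
  compact [set: X] -> (forall x, nbhs x (f x)) ->
  exists s : seq X, forall y, exists2 x, x \in s & f x y.
Proof.
move=> /compact_near_coveringP cX fx.
(* Finite sequences directed by inclusion: a property holds near [F] if it holds for all sequences
   that contain some fixed [r]. *)
pose F := filter_from [set: seq X] (fun r => [set s : seq X | {subset r <= s}]).
have FF : Filter F.
  apply: filter_from_filter; first by exists [::].
  move=> r t _ _; exists (r ++ t) => //= s rts.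
  by split=> x xs; apply: rts; rewrite mem_cat xs ?orbT.
have [|r _ rP] := cX _ F (fun s y => exists2 x, x \in s & f x y) FF.
  move=> x _; exists (f x, [set s : seq X | {subset [:: x] <= s}]).
    by split; [exact: fx|exists [:: x] => // t].
  by move=> [y s] /= [fxy xs]; exists x => //; apply: xs; rewrite mem_head.
by exists r => y; exact: (rP r).
Qed.

Lemma near0_right_ex (R : realType) (P : R -> Prop) :
  (\forall e \near 0^'+, P e) -> exists2 e, 0 < e & P e.
Proof.
move=> nP; have : \forall e \near 0^'+, 0 < e /\ P e.
  by near=> e; split; near: e => //; exact: nbhs_right_gt.
by move=> /filter_ex[e [e0 Pe]]; exists e.
Unshelve. all: by end_near.
Qed.

(** Local bounds near far pairs become uniform because the square of [M] is compact. This serves for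
    the snake-free radius and for the gap between images. *)
Lemma compact_uniform (R : realType) (M : metricType R) (e : R)
    (W : R -> M -> M -> Prop) :
  compact [set: M] ->
  (forall x y, e <= mdist x y -> exists2 r, 0 < r & forall x' y' d,
     ball x r x' -> ball y r y' -> 0 < d < r -> W d x' y') ->
  exists2 d, 0 < d & forall x y, e <= mdist x y -> W d x y.
Proof.
move=> cM Wloc.
have /compact_near_coveringP cMM : compact ([set: M] `*` [set: M]).
  exact: compact_setX.
have /near0_right_ex[d d0 dP] : \forall d \near 0^'+,
    [set: M] `*` [set: M] `<=` [set p | e <= mdist p.1 p.2 -> W d p.1 p.2].
  apply: (cMM R 0^'+ (fun d (p : M * M) => e <= mdist p.1 p.2 -> W d p.1 p.2)).
  move=> [x y] _; have [exy|xye] := leP e (mdist x y).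
    have [r r0 rP] := Wloc _ _ exy.
    exists (ball x r `*` ball y r, [set d | 0 < d < r]).
      split; first by exists (ball x r, ball y r) => //; split; exact: nbhsx_ballx.
      by near=> d; apply/andP; split; near: d; [exact: nbhs_right_gt|exact: nbhs_right_lt].
    by move=> [[x' y'] d] /= [[xx' yy'] dr] _; exact: rP dr.
  (* Near a close pair the claim is void: moving each point by less than half the gap keeps the
     distance below [e]. *)
  pose r := (e - mdist x y) / 2; have r0 : 0 < r by rewrite divr_gt0 // subr_gt0.
  exists (ball x r `*` ball y r, setT).
    split; last exact: filterT.
    by exists (ball x r, ball y r) => //; split; exact: nbhsx_ballx.
  move=> [[x' y'] d] /= [[]]; rewrite !ballEmdist /= => xx' yy' _ ex'y'.
  have := metric_triangle x' x y'; have := metric_triangle x y y'.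
  by rewrite (metric_sym x' x); rewrite /r in xx' yy'; lra.
by exists d => // x y; exact: (dP (x, y)).
Unshelve. all: by end_near. Qed.

Lemma compact_no_snake (R : realType) (M : metricType R) (T : M -> M -> Prop)
    (s : nat) (e : R) :
  compact [set: M] -> (Snake T <= (s%:Z)%:E)%E -> 0 < e ->
  exists2 d, 0 < d & forall x y, e <= mdist x y ->
    ~ contains_snake T (ball x d) (ball y d) s.+1.
Proof.
move=> cM sT e0.
apply: (@compact_uniform _ _ _
  (fun d x y => ~ contains_snake T (ball x d) (ball y d) s.+1) cM) => x y exy.
have xy : x <> y by move=> xy; move: exy; rewrite xy mdistxx leNgt e0.
have [r r0 nsnake] := Snake_no_snake sT xy.
have r20 : 0 < r / 2 by rewrite divr_gt0.
exists (r / 2) => // x' y' d xx' yy' /andP[d0 dr] [a [aT aU]]; apply: nsnake.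
have sub z z' : ball z (r / 2) z' -> ball z' d `<=` ball z r.
  move=> zz' t z't; apply: le_ball (ball_triangle zz' z't).
  by rewrite [leRHS](splitr r) lerD2l ltW.
exists a; split=> // i /aU; case: ifP => _; exact: sub.
Qed.

(** * The separating map along the moment curve *)

Lemma increasing_net (M : choiceType) (T : M -> M -> Prop) (x0 : M) (r : seq M) :
  strict_total_order T -> exists (n : nat) (c : nat -> M),
    (forall i j, (i < j < n)%N -> T (c i) (c j)) /\
    (forall x, x \in r -> exists2 i, (i < n)%N & c i = x).
Proof.
move=> [T_irr T_tot T_trans].
pose le (x y : M) := `[< x = y \/ T x y >].
have le_total : total le.
  move=> x y; have [xy|/T_tot[[Txy _]|[Tyx _]]] := pselect (x = y).
  - by apply/orP; left; apply/asboolP; left.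
  - by apply/orP; left; apply/asboolP; right.
  - by apply/orP; right; apply/asboolP; right.
have le_trans : transitive le.
  move=> y x z /asboolP[->//|Txy] /asboolP[<-|Tyz]; apply/asboolP; right => //.
  exact: T_trans Tyz.
(* Without repetitions, sorting by the reflexive closure [le] gives a strictly increasing list. *)
pose t := sort le (undup r); exists (size t), (nth x0 t); split.
  move=> i j /andP[ij jt]; have it := ltn_trans ij jt.
  have /asboolP[/eqP|//] := sorted_ltn_nth le_trans x0
    (sort_sorted le_total (undup r)) _ _ it jt ij.
  by rewrite nth_uniq ?sort_uniq ?undup_uniq // ltn_eqF.
move=> x xr; have xt : x \in t by rewrite mem_sort mem_undup.
by exists (index x t); rewrite ?index_mem ?nth_index.
Qed.

Section Separation.
Variables (R : realType) (M : metricType R) (T : M -> M -> Prop).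
Variables (n : nat) (c : nat -> M) (d : R).

Definition hat (i : nat) (x : M) : R := Num.max (d - mdist x (c i)) 0.

Definition moment (k : nat) (x : M) : R := \sum_(i < n) hat i x * i%:R ^+ k.

(** Coordinate [k] of the barycentre. Since [moment 0] is the total weight, coordinate 0 is 1
    wherever that weight is non-zero. *)
Definition moment_curve (k : nat) (x : M) : R := moment k x / moment 0 x.

Lemma hat_ge0 i x : 0 <= hat i x.
Proof. by rewrite /hat le_max lexx orbT. Qed.

Lemma hat_gt0 i x : 0 < hat i x -> ball x d (c i).
Proof. by rewrite /hat lt_max ltxx orbF subr_gt0 ballEmdist. Qed.

Lemma continuous_mdist (y : M) : continuous (fun x : M => mdist x y).
Proof.
move=> x; apply/cvgrPdist_lt => e e0; near=> z.
have : ball x e z by near: z; exact: nbhsx_ballx.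
rewrite ballEmdist /= => xz.
have := metric_triangle x z y; have := metric_triangle z x y.
rewrite (metric_sym z x) ltr_norml => ? ?; apply/andP; split; lra.
Unshelve. all: by end_near. Qed.

Lemma continuous_moment k : continuous (moment k).
Proof.
apply: continuous_big => [|i _ x]; first exact: add_continuous.
apply: cvgM; last exact: cvg_cst.
apply: (@continuous_max _ _ (fun x => d - mdist x (c i)) (fun=> 0)).
  by apply: cvgB; [exact: cvg_cst|exact: continuous_mdist].
exact: cvg_cst.
Qed.

Hypothesis c_incr : forall i j, (i < j < n)%N -> T (c i) (c j).
Hypothesis c_net : forall x, exists2 i, (i < n)%N & ball x d (c i).

Lemma moment0_gt0 x : 0 < moment 0 x.
Proof.
have [i ni] := c_net x; rewrite ballEmdist /= => xi.
rewrite /moment (bigD1 (Ordinal ni)) //= mulr1 ltr_wpDr //.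
  by apply: sumr_ge0 => j _; rewrite mulr1 hat_ge0.
by rewrite /hat lt_max subr_gt0 xi.
Qed.

Lemma continuous_moment_curve k : continuous (moment_curve k).
Proof.
move=> x; apply: cvgM; first exact: continuous_moment.
by apply: cvgV; [rewrite gt_eqF ?moment0_gt0|exact: continuous_moment].
Qed.

Lemma moment_curve_sep (s : nat) (x y : M) :
  d + d <= mdist x y ->
  (forall k, (0 < k <= s)%N -> moment_curve k x = moment_curve k y) ->
  contains_snake T (ball x d) (ball y d) s.+1 \/
  contains_snake T (ball y d) (ball x d) s.+1.
Proof.
(* Swapping [x] and [y] negates the difference of weights, so its first non-zero value may be taken
   positive; hence the two cases of the conclusion. *)
wlog : x y / exists i0, [/\ (i0 < n)%N,
    0 < hat i0 x / moment 0 x - hat i0 y / moment 0 y &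
    forall i, (i < i0)%N ->
      hat i x / moment 0 x - hat i y / moment 0 y = 0].
  move=> wlog_first dxy mxy.
  pose w i := hat i x / moment 0 x - hat i y / moment 0 y.
  (* A net point within [d] of [x] is not within [d] of [y], so [w] does not vanish there. *)
  have exw : exists i, (i < n)%N && (w i != 0).
    have [i ni xi] := c_net x; exists i; rewrite ni /w.
    have -> : hat i y = 0.
      apply/eqP; rewrite eq_le hat_ge0 andbT leNgt; apply/negP => /hat_gt0 yi.
      move: xi yi dxy; rewrite !ballEmdist /= => xi yi.
      by have := metric_triangle x (c i) y; rewrite (metric_sym (c i)); lra.
    rewrite mul0r subr0 mulf_neq0 ?invr_eq0 ?gt_eqF ?moment0_gt0 //.
    by move: xi; rewrite ballEmdist /hat lt_max subr_gt0 => ->.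
  have [i0 /andP[ni0 wi0] i0_min] := ex_minnP exw.
  have w0 i : (i < i0)%N -> w i = 0.
    move=> ii0; apply/eqP; apply: contraTT ii0 => wi; rewrite -leqNgt.
    have [ni|ni] := ltnP i n; first by rewrite i0_min ?ni.
    exact: leq_trans (ltnW ni0) ni.
  have [wpos|wneg] := ltP 0 (w i0).
    by apply: wlog_first => //; exists i0.
  apply/or_comm; apply: wlog_first; last 2 first.
  - by rewrite metric_sym.
  - by move=> k ks; rewrite mxy.
  exists i0; split=> // [|i ii0].
    by rewrite -opprB oppr_gt0 lt_neqAle wi0.
  by rewrite -opprB -/(w i) w0 ?oppr0.
move=> [i0 [ni0 wi0 w0]] dxy mxy; left.
(* Moments 1 to [s] vanish because the images agree, moment 0 because both weights sum to 1. These
   [s + 1] moments yield [s + 2] alternating indices. *)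
have [|a [a_incr a_n a_alt]] := @moments_alternation R s.+1 n
  (fun i => hat i x / moment 0 x - hat i y / moment 0 y) i0 ni0 wi0 w0.
  move=> k ks.
  transitivity (moment_curve k x - moment_curve k y).
    rewrite /moment_curve /moment !mulr_suml -sumrB.
    by apply: eq_bigr => i _; rewrite mulrBl; congr (_ - _); rewrite mulrAC.
  case: k ks => [_|k ks]; last by rewrite mxy ?subrr.
  by rewrite /moment_curve !divff ?subrr ?gt_eqF ?moment0_gt0.
exists (c \o a); split=> i ik /=.
  by apply: c_incr; rewrite a_incr ?a_n.
have pos z : 0 < hat (a i) z / moment 0 z -> ball z d (c (a i)).
  by rewrite pmulr_lgt0 ?invr_gt0 ?moment0_gt0 // => /hat_gt0.
have ge0 z : 0 <= hat (a i) z / moment 0 z.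
  by rewrite divr_ge0 ?hat_ge0 ?ltW ?moment0_gt0.
have := a_alt i ik; rewrite -signr_odd; case: ifP => _ wi; apply: pos.
  have := ge0 x; move: wi; rewrite expr1; lra.
have := ge0 y; move: wi; rewrite expr0; lra.
Qed.

End Separation.

(** * Covers of order at most [s] from shifted grids of cubes *)

Section ShiftedGrids.
Variables (R : realType) (X : topologicalType) (s : nat).
Variables (g : 'I_s -> X -> R) (rho : R).

(** The walls of grid [c] are the integer values. Shifts by distinct multiples of [1 / (s + 1)]
    below 1 keep the walls of different grids apart. *)
Definition shifted_coord (c : 'I_s.+1) (k : 'I_s) (p : X) : R :=
  g k p / rho - c%:R / s.+1%:R.

(** Preimage of the open cube of grid [c] around the image of [p]; empty if [p] lies on a wall. *)
Definition cell (c : 'I_s.+1) (p : X) : set X :=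
  [set q | forall k, exists z : int,
    z%:~R < shifted_coord c k p < z%:~R + 1 /\
    z%:~R < shifted_coord c k q < z%:~R + 1].

(** The integer below a coordinate off the walls is unique, so cells of one grid that meet
    coincide. *)
Lemma cell_eq c p q : cell c p q -> cell c p = cell c q.
Proof.
move=> pq; apply/seteqP; split=> r pr k.
  have [z [pz qz]] := pq k; have [z' [pz' rz']] := pr k.
  suff zz' : z = z' by exists z; split=> //; rewrite zz'.
  apply/eqP; rewrite eq_le -!ltzD1 -!(ltr_int R) !intrD.
  by apply/andP; split; lra.
have [z [pz qz]] := pq k; have [z' [qz' rz']] := pr k.
suff zz' : z = z' by exists z; split=> //; rewrite zz'.
apply/eqP; rewrite eq_le -!ltzD1 -!(ltr_int R) !intrD.
by apply/andP; split; lra.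
Qed.

Lemma cell_dist c p q q' k : 0 < rho -> cell c p q -> cell c p q' ->
  `|g k q - g k q'| < rho.
Proof.
move=> rho0 pq; rewrite (cell_eq pq) => qq'.
have [z []] := qq' k; rewrite /shifted_coord => zq zq'.
have -> : g k q - g k q' = (g k q / rho - g k q' / rho) * rho.
  by rewrite mulrBl !divfK ?gt_eqF.
rewrite normrM (gtr0_norm rho0) gtr_pMl // ltr_norml.
move: (_ / rho) (_ / rho) (_ / _) zq zq' => u v t zq zq'.
by apply/andP; split; lra.
Qed.

Lemma open_cell c p : (forall k, continuous (g k)) -> open (cell c p).
Proof.
move=> g_cont; rewrite openE => q pq.
have cont k : continuous (shifted_coord c k).
  move=> x; apply: cvgB; last exact: cvg_cst.
  by apply: cvgM; [exact: g_cont|exact: cvg_cst].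
rewrite /interior /cell.
apply: filter_forall => k; have [z [pz /andP[zq qz]]] := pq k.
near=> r; exists z; split=> //; apply/andP; split; near: r.
  exact: (cvgr_gt _ (cont k q)).
exact: (cvgr_lt _ (cont k q)).
Unshelve. all: by end_near. Qed.

(* Each of the [s] coordinates lies on the boundary of the cubes of at most one
   of the [s.+1] shifted grids. *)
Lemma cell_center p : exists c, cell c p p.
Proof.
apply: contrapT => nc.
have bad c : exists k, exists z : int, shifted_coord c k p = z%:~R.
  apply: contrapT => nk; apply: nc; exists c => k.
  exists (Num.floor (shifted_coord c k p)).
  have := Num.Theory.floor_itv (shifted_coord c k p).
  rewrite intrD le_eqVlt => /andP[/orP[/eqP zk|->] ->] //.
  by exfalso; apply: nk; exists k, (Num.floor (shifted_coord c k p)).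
have [K KP] := choice bad.
(* Pigeonhole: [s + 1] grids, but only [s] coordinates. *)
have [c [c' [cc' Kcc']]] : exists c, exists c', c != c' /\ K c = K c'.
  apply: contrapT => nK; have /leq_card : injective K.
    move=> c c' Kcc'; apply/eqP; apply: contrapT => /negP cc'.
    by apply: nK; exists c, c'.
  by rewrite !card_ord ltnn.
have [z pz] := KP c; have [z' pz'] := KP c'.
rewrite /shifted_coord -Kcc' in pz pz'.
(* Then [c - c'] is a non-zero multiple of [s + 1], yet smaller than [s + 1] in absolute value. *)
have : c%:Z - c'%:Z = (z' - z) * s.+1%:Z.
  apply: (@intr_inj R); rewrite rmorphM !rmorphB /= -pz -pz'.
  rewrite -!pmulrn; move: (_ / rho) => u.
  by field; rewrite nat1r pnatr_eq0.
have := ltn_ord c; have := ltn_ord c'.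
move: cc'; rewrite -(inj_eq val_inj) /= => /eqP.
move: (nat_of_ord c) (nat_of_ord c') (z' - z) => i j m ij js i_s ijm.
have [|m1] : m = 0 \/ (1 <= m \/ m <= -1) by lia.
  by move=> m0; apply: ij; move: ijm; rewrite m0 mul0r; lia.
by case: m1 => m1; nia.
Qed.

(** Each point is given a grid whose walls it avoids, and finitely many of these cells suffice. A
    point lies in at most one cell of each of the [s + 1] grids, whence the order. *)
Lemma shifted_grid_cover : compact [set: X] -> (forall k, continuous (g k)) ->
  0 < rho -> exists B : set (set X), [/\ finite_open_cover B,
    forall V, B V -> V !=set0,
    forall V p q k, B V -> V p -> V q -> `|g k p - g k q| < rho
    & (family_order B <= (s%:Z)%:E)%E].
Proof.
move=> cX g_cont rho0; have [c cP] := choice cell_center.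
have [r rP] := @compact_nbhs_subcover X (fun p => cell (c p) p) cX
  (fun p => open_nbhs_nbhs (conj (open_cell _ _ g_cont) (cP p))).
exists [set cell (c p) p | p in [set` r]]; split.
- split; first exact/finite_image/finite_seq.
    by move=> _ [p _ <-]; exact: open_cell.
  apply/seteqP; split=> // q _; have [p pr pq] := rP q.
  by exists (cell (c p) p) => //; exists p.
- by move=> _ [p _ <-]; exists p.
- by move=> _ p q k [p0 _ <-]; exact: cell_dist.
- apply: family_order_le => q; exists (cell ^~ q) => _ [p _ <-] pq.
  by exists (c p); exact: cell_eq.
Qed.

End ShiftedGrids.

(** * Lebesgue number, separating map and conclusion *)

Lemma lebesgue_number (R : realType) (M : metricType R) (A : set (set M)) :
  compact [set: M] -> finite_open_cover A ->
  exists2 e : R, 0 < e & forall x, exists2 U, A U & ball x e `<=` U.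
Proof.
move=> /compact_near_coveringP cM [_ Aopen Acov].
have /near0_right_ex[e e0 eP] : \forall e \near 0^'+,
    [set: M] `<=` [set x | exists2 U, A U & ball x e `<=` U].
  apply: (cM R 0^'+ (fun e x => exists2 U, A U & ball x e `<=` U)) => x _.
  have [U AU Ux] : (\bigcup_(U in A) U) x by rewrite Acov.
  have /nbhs_ballP[r /= r0 rU] := open_nbhs_nbhs (conj (Aopen _ AU) Ux).
  exists (ball x (r / 2), [set e | e < r / 2]).
    split; first by apply: nbhsx_ballx; rewrite divr_gt0.
    by apply: nbhs_right_lt; rewrite divr_gt0.
  move=> [y e] /= [xy er]; exists U => // z yz; apply: rU.
  by apply: le_ball (ball_triangle xy yz); rewrite [leRHS](splitr r) lerD2l ltW.
by exists e => // x; exact: eP.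
Qed.

Lemma snake_separating_map (s : nat) (R : realType) (M : metricType R)
    (T : M -> M -> Prop) (e : R) :
  compact [set: M] -> strict_total_order T -> (Snake T <= (s%:Z)%:E)%E ->
  0 < e -> exists g : 'I_s -> M -> R, (forall k, continuous (g k)) /\
    forall x y, e <= mdist x y -> exists k, g k x <> g k y.
Proof.
move=> cM T_order sT e0.
have [d1 d10 nsnake] := compact_no_snake cM sT e0.
have [[x0 _]|M0] := pselect (exists x : M, True); last first.
  exists (fun=> fun=> 0); split=> [k|x]; first exact: cst_continuous.
  by exfalso; apply: M0; exists x.
(* [d1] excludes the snakes; [e / 2] ensures that far points are at least [d + d] apart. *)
pose d := Num.min d1 (e / 2).
have d0 : 0 < d by rewrite lt_min d10 divr_gt0.
have [r rP] := @compact_nbhs_subcover M (ball ^~ d) cM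
  (fun x => nbhsx_ballx x d d0).
have [n [c [c_incr c_surj]]] := increasing_net x0 r T_order.
have c_net x : exists2 i, (i < n)%N & ball x d (c i).
  have [p /c_surj[i ni <-] px] := rP x; exists i => //; exact: ball_sym.
(* Indices start at 1, since coordinate 0 is constant. *)
exists (fun k => moment_curve n c d k.+1); split=> [k|x y exy].
  exact: continuous_moment_curve.
apply: contrapT => ngk.
have sub z : ball z d `<=` ball z d1 by apply: le_ball; rewrite ge_min lexx.
have no_snake x' y' : e <= mdist x' y' ->
    ~ contains_snake T (ball x' d) (ball y' d) s.+1.
  move=> /nsnake nxy [a [aT aU]]; apply: nxy; exists a; split=> // i /aU.
  by case: ifP => _; exact: sub.
have [||/no_snake|/no_snake] := moment_curve_sep c_incr c_net (s := s) (x := x) (y := y).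
- by apply: le_trans exy; rewrite [leRHS]splitr lerD // ge_min lexx orbT.
- move=> [//|k] /= ks; apply: contrapT => gk.
  by apply: ngk; exists (Ordinal ks).
- exact.
- by rewrite metric_sym; exact.
Qed.

Theorem theorem1p2 (s : nat) (R : realType) (M : metricType R)
    (T : M -> M -> Prop) :
  compact [set: M] -> strict_total_order T ->
  (Snake T <= (s%:Z)%:E)%E -> (covering_dim M <= (s%:Z)%:E)%E.
Proof.
move=> cM T_order sT; apply: covering_dim_least => A Acov.
have [e e0 eA] := lebesgue_number cM Acov.
have [g [g_cont g_sep]] := snake_separating_map cM T_order sT e0.
(* Compactness turns separation into a uniform gap [rho], which becomes the mesh of the grids. *)
have [rho rho0 g_far] : exists2 rho, 0 < rho & forall x y : M,
    e <= mdist x y -> exists k, rho <= `|g k x - g k y|.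
  apply: (@compact_uniform _ _ _
    (fun rho x y => exists k, rho <= `|g k x - g k y|) cM) => x y exy.
  have [k gk] := g_sep _ _ exy; pose a := `|g k x - g k y|.
  (* Moving both points costs less than two thirds of [a]; the remaining third exceeds [rho]. *)
  have a0 : 0 < a / 3 by rewrite divr_gt0 // normr_gt0 subr_eq0; apply/eqP.
  have near_eq z : exists2 r, 0 < r &
      forall z', ball z r z' -> `|g k z - g k z'| < a / 3.
    have /cvgrPdist_lt/(_ _ a0)/nbhs_ballP[r r0 rP] := g_cont k z.
    by exists r.
  have [r1 r10 r1P] := near_eq x; have [r2 r20 r2P] := near_eq y.
  exists (Num.min (a / 3) (Num.min r1 r2)); first by rewrite !lt_min a0 r10.
  move=> x' y' rho xx' yy' /andP[_]; rewrite lt_min => /andP[rhoa _].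
  have {}xx' : `|g k x - g k x'| < a / 3.
    by apply: r1P; apply: le_ball xx'; rewrite !ge_min lexx !orbT.
  have {}yy' : `|g k y - g k y'| < a / 3.
    by apply: r2P; apply: le_ball yy'; rewrite !ge_min lexx !orbT.
  exists k; have : a <= `|g k x - g k x'| + `|g k x' - g k y'| + `|g k y - g k y'|.
    rewrite (distrC (g k y)); apply: le_trans (ler_distD (g k y') _ _) _.
    by rewrite lerD2r ler_distD.
  lra.
have [B [Bcov B_ne B_small B_order]] := shifted_grid_cover cM g_cont rho0.
exists B; split=> // V BV; have [x Vx] := B_ne _ BV; have [U AU xU] := eA x.
(* Images of points of [V] differ by less than [rho] in every coordinate, so the points are less
   than [e] apart. *)
exists U => // y Vy; apply: xU; rewrite ballEmdist /= ltNge; apply/negP.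
by move=> /g_far[k]; rewrite leNgt (B_small V).
Qed.
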